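(* Let $\mathcal{A}$ be a $(\Gamma,\lambda)$-commutative algebra, $M$ a free graded $\mathcal{A}$-module of finite rank and $\varsigma\in\mathfrak{S}(\lambda)$. Then $\Gamma\mathrm{tr}:=\mathrm{str}\circ\eta_\varsigma:\mathcal{E}nd_{\mathcal{A}}(M)\to\mathcal{A}$ is a graded trace, it does not depend on the choice of $\varsigma\in\mathfrak{S}(\lambda)$, and it is the unique graded trace up to multiplication by a scalar in $\mathcal{A}^0$: every graded trace $\mathcal{E}nd_{\mathcal{A}}(M)\to\mathcal{A}$ is of the form $a\cdot\Gamma\mathrm{tr}$ with $a\in\mathcal{A}^0$.
   Context: $\mathbb{K}$ is a field of characteristic zero and $\Gamma$ is a finitely generated abelian group (written additively). A commutation factor is a biadditive map $\lambda:\Gamma\times\Gamma\to\mathbb{K}^\times$ with $\lambda(x,y)\lambda(y,x)=1$. A $(\Gamma,\lambda)$-commutative algebra is an associative unital $\Gamma$-graded $\mathbb{K}$-algebra $\mathcal{A}=\bigoplus_{\gamma}\mathcal{A}^\gamma$ with $ab=\lambda(\tilde a,\tilde b)\,ba$ for homogeneous $a,b$; $\tilde a$ denotes the degree. Parity: $\bar x\in\mathbb{Z}_2$ is defined by $\lambda(x,x)=(-1)^{\bar x}$; $x\mapsto\bar x$ is a group morphism. $\mathfrak{S}(\lambda)$ is the set of NS-multipliers, i.e. biadditive maps $\varsigma:\Gamma\times\Gamma\to\mathbb{K}^\times$ with $\lambda(x,y)\varsigma(x,y)\varsigma(y,x)^{-1}=(-1)^{\bar x\bar y}$ for all $x,y$.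 For $\varsigma\in\mathfrak{S}(\lambda)$, $\underline{\mathcal{A}}$ is the graded vector space $\mathcal{A}$ with product $a\star b=\varsigma(\tilde a,\tilde b)ab$; it is a ($\Gamma$-graded) supercommutative algebra for the parity. A graded $\mathcal{A}$-module $M=\bigoplus_\gamma M^\gamma$ is a graded vector space with left and right graded $\mathcal{A}$-module structures related by $ma=\lambda(\tilde m,\tilde a)am$; it is free of finite rank if it has a finite basis consisting of homogeneous elements. $\underline{M}$ is the graded vector space $M$ with graded $\underline{\mathcal{A}}$-module structure $a\star m=\varsigma(\tilde a,\tilde m)am$ and $m\star a=(-1)^{\bar{\tilde m}\,\bar{\tilde a}}a\star m$; a homogeneous basis of $M$ is also a basis of $\underline{M}$. $\mathcal{E}nd_{\mathcal{A}}(M)=\bigoplus_\gamma\mathcal{E}nd^\gamma_{\mathcal{A}}(M)$, where $\mathcal{E}nd^\gamma_{\mathcal{A}}(M)$ consists of the right $\mathcal{A}$-linear maps $f:M\to M$ with $f(M^\alpha)\subset M^{\alpha+\gamma}$ for all $\alpha$ (then $\tilde f=\gamma$). It is a graded $\mathcal{A}$-module with $(af)(m)=a f(m)$ and right structure $fa=\lambda(\tilde f,\tilde a)\,af$. The map $\eta_\varsigma:\mathcal{E}nd_{\mathcal{A}}(M)\to\mathcal{E}nd_{\underline{\mathcal{A}}}(\underline{M})$ is given by $\eta_\varsigma(f)(m)=\varsigma(\tilde f,\tilde m)f(m)$ for homogeneous $f,m$. A graded trace is a degree-preserving $\mathcal{A}$-linear map $t:\mathcal{E}nd_{\mathcal{A}}(M)\to\mathcal{A}$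 which is a morphism of $(\Gamma,\lambda)$-Lie algebras for the graded commutators $[u,v]_\lambda=uv-\lambda(\tilde u,\tilde v)vu$; since $\mathcal{A}$ is $\lambda$-commutative this means $t(f\circ g)=\lambda(\tilde f,\tilde g)\,t(g\circ f)$ for homogeneous $f,g$. The supertrace $\mathrm{str}:\mathcal{E}nd_{\underline{\mathcal{A}}}(\underline{M})\to\underline{\mathcal{A}}$ is the usual one: if $(e_i)$ is a homogeneous basis with degrees $\nu_i$ and $h$ is homogeneous of degree $x$ with $h(e_j)=\sum_i e_i\star H^i_{\ j}$, then $\mathrm{str}(h)=\sum_i(-1)^{\bar\nu_i(\bar\nu_i+\bar x)}H^i_{\ i}$. As vector spaces $\underline{\mathcal{A}}=\mathcal{A}$, so $\mathrm{str}\circ\eta_\varsigma$ takes values in $\mathcal{A}$. *)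

(* Defs.v *)
From HB Require Import structures.
From mathcomp Require Import all_boot all_order all_algebra.
From mathcomp Require Import boolp classical_sets functions cardinality fsbigop.

Set Implicit Arguments.
Unset Strict Implicit.
Unset Printing Implicit Defensive.

Import GRing.Theory.
Local Open Scope classical_set_scope.
Local Open Scope ring_scope.

Definition finitely_generated (G : zmodType) : Prop :=
  exists s : seq G, forall x : G,
    exists c : 'I_(size s) -> int, x = \sum_(i < size s) s`_i *~ c i.

Section Gradings.
Variables (G : zmodType) (V : zmodType).
Implicit Types (Vg : G -> set V) (v : V) (f : G -> V).

Definition decomposes Vg v f : Prop :=
  [/\ forall x, Vg x (f x),
      finite_set [set x | f x != 0]
    & v = \sum_(x \in [set: G]) f x].

Definition is_grading Vg : Prop :=
  [/\ forall x, Vg x 0,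
      forall x u v, Vg x u -> Vg x v -> Vg x (u - v)
    & forall v, exists! f, decomposes Vg v f].

(* [hcomp Vg v x] is the component of [v] in [Vg x] (junk value 0 if [v] is not
   a finite sum of homogeneous elements). *)
Definition hcomp Vg v : G -> V := xget (fun=> 0) [set f | decomposes Vg v f].

End Gradings.

Section CommutationFactors.
Variables (K : fieldType) (G : zmodType).
Implicit Types lam sigma : G -> G -> K.

Definition biadditive lam : Prop :=
  [/\ forall x y, lam x y != 0,
      forall x y z, lam (x + y) z = lam x z * lam y z
    & forall x y z, lam x (y + z) = lam x y * lam x z].

Definition commutation_factor lam : Prop :=
  biadditive lam /\ forall x y, lam x y * lam y x = 1.

(* [lam x x] is 1 or -1; the parity is [true] (odd) in the latter case. *)
Definition parity lam (x : G) : bool := lam x x == -1.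

Definition NS_multiplier lam sigma : Prop :=
  biadditive sigma /\
  forall x y, lam x y * sigma x y * (sigma y x)^-1
              = (-1) ^+ (parity lam x * parity lam y)%N.

End CommutationFactors.

(* A unital K-algebra is given by a ring [A] and its structure map
   [iota : K -> A] with central image; [algType K] would exclude the zero
   algebra.  A scalar [k] acts on [A] as [iota k * _], and on an [A]-module as
   [iota k *: _]. *)
Section GradedAlgebra.
Variables (K : fieldType) (G : zmodType) (lam : G -> G -> K).
Variables (A : pzRingType) (iota : {rmorphism K -> A}).

Record graded_commutative_algebra (Ag : G -> set A) : Prop := {
  iota_central : forall k a, iota k * a = a * iota k;
  alg_grading : is_grading Ag;
  alg_homogZ : forall x k a, Ag x a -> Ag x (iota k * a);
  alg_homog1 : Ag 0 1;
  alg_homogM : forall x y a b, Ag x a -> Ag y b -> Ag (x + y) (a * b);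
  alg_lam_comm : forall x y a b, Ag x a -> Ag y b ->
    a * b = iota (lam x y) * (b * a)
}.

Variables (Ag : G -> set A) (M : lmodType A).

(* The left action is [*:], the right one is [ract].  The [Mg x] are
   K-subspaces because [iota k] lies in [Ag 0]. *)
Record graded_module (Mg : G -> set M) (ract : M -> A -> M) : Prop := {
  mod_grading : is_grading Mg;
  mod_homogZ : forall x y a m, Ag x a -> Mg y m -> Mg (x + y) (a *: m);
  ractDl : forall m n a, ract (m + n) a = ract m a + ract n a;
  ractDr : forall m a b, ract m (a + b) = ract m a + ract m b;
  ractA : forall m a b, ract m (a * b) = ract (ract m a) b;
  ract1 : forall m, ract m 1 = m;
  ract_homog : forall x y m a, Mg x m -> Ag y a -> Mg (x + y) (ract m a);
  ract_lam : forall x y m a, Mg x m -> Ag y a ->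
    ract m a = iota (lam x y) *: (a *: m)
}.

Variable Mg : G -> set M.

Record homogeneous_basis : Type := HomogeneousBasis {
  hb_rank : nat;
  hb_vec : 'I_hb_rank -> M;
  hb_deg : 'I_hb_rank -> G;
  hb_homog : forall i, Mg (hb_deg i) (hb_vec i);
  hb_basis : forall m : M, exists! c : 'I_hb_rank -> A,
    m = \sum_i c i *: hb_vec i
}.

Arguments hb_vec : clear implicits.
Arguments hb_deg : clear implicits.

Section Endomorphisms.
Variable act : M -> A -> M.

(* The homogeneous component of degree [x] of the algebra of endomorphisms that
   are linear for the right action [act]. *)
Definition hEnd (x : G) : set (M -> M) := [set f |
  [/\ forall m n, f (m + n) = f m + f n,
      forall m a, f (act m a) = act (f m) a
    & forall y m, Mg y m -> Mg (y + x) (f m)]].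

Definition gEnd : set (M -> M) := [set f | exists F, decomposes hEnd f F].

Definition rcoord (n : nat) (e : 'I_n -> M) (m : M) : 'I_n -> A :=
  xget (fun=> 0) [set c | m = \sum_i act (e i) (c i)].

End Endomorphisms.

Section Twisting.
Variable sigma : G -> G -> K.

(* Bilinear extensions of a * m = sigma(deg a, deg m) a m and of
   m * a = (-1)^(par m par a) a * m. *)
Definition star_lact (a : A) (m : M) : M :=
  \sum_(x \in [set: G]) \sum_(y \in [set: G])
    iota (sigma x y) *: (hcomp Ag a x *: hcomp Mg m y).

Definition star_ract (m : M) (a : A) : M :=
  \sum_(x \in [set: G]) \sum_(y \in [set: G])
    iota ((-1) ^+ (parity lam x * parity lam y)%N)
      *: star_lact (hcomp Ag a y) (hcomp Mg m x).

Definition eta (ract : M -> A -> M) (f : M -> M) : M -> M := fun m =>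
  \sum_(x \in [set: G]) \sum_(y \in [set: G])
    iota (sigma x y) *: hcomp (hEnd ract) f x (hcomp Mg m y).

(* The supertrace on the endomorphisms of the twisted module, computed in the
   homogeneous basis [b]: the summand of index [x] is the supertrace of the
   component of degree [x] of [h]. *)
Definition str (b : homogeneous_basis) (h : M -> M) : A :=
  \sum_(x \in [set: G]) \sum_(i < hb_rank b)
    (-1) ^+ (parity lam (hb_deg b i)
             * (parity lam (hb_deg b i) + parity lam x))%N
    * rcoord star_ract (hb_vec b) (hcomp (hEnd star_ract) h x (hb_vec b i)) i.

Definition Gtr (ract : M -> A -> M) (b : homogeneous_basis) (f : M -> M) : A :=
  str b (eta ract f).

End Twisting.

(* Graded commutators of elements of degrees [x] and [y]. *)
Definition alg_bracket (x y : G) (a b : A) : A :=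
  a * b - iota (lam x y) * (b * a).

Definition End_bracket (x y : G) (f g : M -> M) : M -> M :=
  f \o g - iota (lam x y) *: (g \o f).

(* Only the values of [t] on [gEnd ract] matter. *)
Record graded_trace (ract : M -> A -> M) (t : (M -> M) -> A) : Prop := {
  gtraceD : forall f g, gEnd ract f -> gEnd ract g -> t (f + g) = t f + t g;
  gtraceZ : forall a f, gEnd ract f -> t (a *: f) = a * t f;
  gtrace_homog : forall x f, hEnd ract x f -> Ag x (t f);
  gtrace_bracket : forall x y f g, hEnd ract x f -> hEnd ract y g ->
    t (End_bracket x y f g) = alg_bracket x y (t f) (t g)
}.

End GradedAlgebra.

Arguments hb_vec {G A M Mg} _ _.
Arguments hb_deg {G A M Mg} _ _.

(* Main.v *)
(* In left coordinates the twists cancel: if [f e_j = \sum_i F_ij e_i], then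
   [Gtr f = \sum_i lam(nu_i, nu_i) F_ii], where [nu_i] is the degree of [e_i];
   the right-hand side does not involve sigma.  The diagonal [x |-> lam(x, x)]
   is a character with values in [{1, -1}], and commuting coefficients past each
   other shows that [\sum_i lam(nu_i, nu_i) (f g)_ii] computed in one basis is
   [lam(deg f, deg g)] times the corresponding sum for [g f] in another basis.
   This gives the trace property and the independence of the basis at once.
   Conversely, for the right linear matrix units [E_ij], the relations
   [E_ij = E_ij E_jj] and [E_ii = E_ij E_ji] force any graded trace to vanish on
   [E_ij] for [i <> j] and determine its value on [E_ii] from that on one
   [E_kk]. *)
Require Import Defs.
From HB Require Import structures.
From mathcomp Require Import all_boot all_order all_algebra.
From mathcomp Require Import ring finmap.
From mathcomp Require Import boolp classical_sets functions cardinality fsbigop.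

Set Implicit Arguments.
Unset Strict Implicit.
Unset Printing Implicit Defensive.

Import GRing.Theory.
Local Open Scope classical_set_scope.
Local Open Scope ring_scope.

(** * Sums of finitely supported families *)

Section FiniteSupport.
Variables (I : choiceType) (V : nmodType).
Implicit Types (h : I -> V) (S : set I).

Lemma fsum_sub S h : finite_set S -> (forall x, h x != 0 -> S x) ->
  \sum_(x \in [set: I]) h x = \sum_(x <- fset_set S) h x.
Proof.
move=> finS hS; apply: fsbigTE => x.
rewrite in_fset_set // => xS; apply/eqP; apply: contraNT xS => /hS.
by rewrite inE.
Qed.

Lemma fsum_single x v h : h x = v -> (forall y, y != x -> h y = 0) ->
  \sum_(y \in [set: I]) h y = v.
Proof.
move=> hx h0; rewrite (@fsum_sub [set x]) //; last first.
  by move=> y /=; apply: contra_neqP => /eqP; apply: h0.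
by rewrite fset_set1 big_seq_fset1.
Qed.

Lemma fsumD h h' : finite_set [set x | h x != 0] ->
  finite_set [set x | h' x != 0] ->
  \sum_(x \in [set: I]) (h x + h' x) =
  \sum_(x \in [set: I]) h x + \sum_(x \in [set: I]) h' x.
Proof.
move=> fh fh'; have fU : finite_set ([set x | h x != 0] `|` [set x | h' x != 0]).
  by rewrite finite_setU.
rewrite !(fsum_sub fU) ?big_split //= => x hx; [by right | by left |].
have [h0|] := eqVneq (h x) 0; last by left.
by right; move: hx; rewrite h0 add0r.
Qed.

Lemma finite_suppD h h' : finite_set [set x | h x != 0] ->
  finite_set [set x | h' x != 0] -> finite_set [set x | h x + h' x != 0].
Proof.
move=> fh fh'; have fU : finite_set ([set x | h x != 0] `|` [set x | h' x != 0]).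
  by rewrite finite_setU.
apply: sub_finite_set fU => x /= hx.
have [h0|] := eqVneq (h x) 0; last by left.
by right; move: hx; rewrite h0 add0r.
Qed.

End FiniteSupport.

(** * Direct sums of homogeneous components and maps defined degree by degree *)

Section Pregradings.
Variables (G V : zmodType).
Implicit Types (Vg : G -> set V) (u v : V) (x y : G).

(* Weaker than [is_grading]: the sum of the [Vg x] is direct but need not be
   everything.  This covers the homogeneous endomorphisms, which do not span
   all maps. *)
Record pregrading Vg : Prop := {
  pregrading0 : forall x, Vg x 0;
  pregradingB : forall x u v, Vg x u -> Vg x v -> Vg x (u - v);
  pregrading_uniq : forall v f g,
    decomposes Vg v f -> decomposes Vg v g -> f = g
}.

(** For [Vg := hEnd Mg act] this is membership in [gEnd Mg act] by conversion, so the induction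
    principle below also applies to graded endomorphisms. *)
Definition decomposable Vg v := exists f, decomposes Vg v f.

Lemma grading_pregrading Vg : is_grading Vg -> pregrading Vg.
Proof.
case=> V0 VB Vu; split=> // v f g vf vg.
by have [h [_ hu]] := Vu v; rewrite -(hu _ vf) (hu _ vg).
Qed.

Lemma grading_decomposable Vg v : is_grading Vg -> decomposable Vg v.
Proof. by case=> _ _ /(_ v)[f [fP _]]; exists f. Qed.

Section Theory.
Variable Vg : G -> set V.
Hypothesis VgP : pregrading Vg.

Lemma homogN x v : Vg x v -> Vg x (- v).
Proof.
by move=> xv; rewrite -sub0r; apply: pregradingB => //; apply: pregrading0.
Qed.

Lemma homogD x u v : Vg x u -> Vg x v -> Vg x (u + v).
Proof.
by move=> xu xv; rewrite -[v]opprK; apply: pregradingB => //; apply: homogN.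
Qed.

Lemma homog_sum x (I : Type) (r : seq I) (P : pred I) (F : I -> V) :
  (forall i, P i -> Vg x (F i)) -> Vg x (\sum_(i <- r | P i) F i).
Proof.
by move=> xF; elim/big_ind: _ => //; [apply: pregrading0 | apply: homogD].
Qed.

Lemma decomposesD u v f g : decomposes Vg u f -> decomposes Vg v g ->
  decomposes Vg (u + v) (f + g).
Proof.
move=> [uf ff fE] [vg fg gE]; split=> [x||].
- exact: homogD.
- exact: finite_suppD.
- by rewrite fE gE -fsumD.
Qed.

Lemma decomposes_homog x v :
  Vg x v -> decomposes Vg v (fun y => if y == x then v else 0).
Proof.
move=> xv; split=> [y||].
- by case: eqP => [->|_] //; apply: pregrading0.
- apply: sub_finite_set (finite_set1 x) => y /=.
  by case: (y =P x) => // _; rewrite eqxx.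
- by apply/esym/(@fsum_single _ _ x) => [|y /negbTE->]; rewrite ?eqxx.
Qed.

Lemma homog_decomposable x v : Vg x v -> decomposable Vg v.
Proof. by move=> xv; eexists; apply: decomposes_homog xv. Qed.

Lemma decomposableD u v :
  decomposable Vg u -> decomposable Vg v -> decomposable Vg (u + v).
Proof. by move=> [f uf] [g vg]; exists (f + g); apply: decomposesD. Qed.

(** Main reduction to homogeneous elements. The additive case provides decomposability of both
    summands, because [hcomp] is additive only on decomposable elements. *)
Lemma decomposable_ind (P : V -> Prop) :
  (forall x v, Vg x v -> P v) ->
  (forall u v, decomposable Vg u -> decomposable Vg v -> P u -> P v -> P (u + v)) ->
  forall v, decomposable Vg v -> P v.
Proof.
move=> Ph PD v [f [fh ff ->]]; rewrite (fsum_sub ff) //.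
(* Decomposability of the partial sums is carried along, since the additive case asks for it. *)
suff [] : decomposable Vg (\sum_(x <- fset_set [set x | f x != 0]) f x)
  /\ P (\sum_(x <- fset_set [set x | f x != 0]) f x) by [].
elim/big_ind: _ => [|u w [du Pu] [dw Pw]|x _].
- by split; [apply: homog_decomposable (pregrading0 VgP 0)
            | apply: Ph (pregrading0 VgP 0)].
- by split; [apply: decomposableD | apply: PD].
- by split; [apply: homog_decomposable (fh x) | apply: Ph (fh x)].
Qed.

Lemma hcomp_uniq v f : decomposes Vg v f -> hcomp Vg v = f.
Proof.
by move=> vf; apply: xget_unique => // g vg; apply: (pregrading_uniq VgP vg vf).
Qed.

Lemma hcompP v : decomposable Vg v -> decomposes Vg v (hcomp Vg v).
Proof. by move=> [f vf]; rewrite (hcomp_uniq vf). Qed.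

Lemma hcomp_homog x v : Vg x v -> hcomp Vg v = fun y => if y == x then v else 0.
Proof. by move=> /decomposes_homog/hcomp_uniq. Qed.

Lemma hcompD u v : decomposable Vg u -> decomposable Vg v ->
  hcomp Vg (u + v) = hcomp Vg u + hcomp Vg v.
Proof.
by move=> /hcompP du /hcompP dv; apply: hcomp_uniq; apply: decomposesD.
Qed.

Section Extension.
Variables (W : nmodType) (F : G -> V -> W).

(** Extends maps [F x], meaningful in degree [x] only, to sums of homogeneous elements. The
    operations [star_lact], [star_ract], [eta] and [str] are all (iterated) instances, which is how
    they are evaluated and shown to be additive. *)
Definition gext v : W := \sum_(x \in [set: G]) F x (hcomp Vg v x).

Hypothesis F0 : forall x, F x 0 = 0.

Lemma gext_homog x v : Vg x v -> gext v = F x v.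
Proof.
move=> xv; apply: (@fsum_single _ _ x) => [|y /negbTE yx];
  by rewrite (hcomp_homog xv) ?eqxx ?yx.
Qed.

Lemma gext_finite_supp v : decomposable Vg v ->
  finite_set [set x | F x (hcomp Vg v x) != 0].
Proof.
move=> /hcompP[_ fv _]; apply: sub_finite_set fv => x /=.
by apply: contra_neq => ->.
Qed.

Hypothesis FD : forall x u v, Vg x u -> Vg x v -> F x (u + v) = F x u + F x v.

Lemma gextD u v : decomposable Vg u -> decomposable Vg v ->
  gext (u + v) = gext u + gext v.
Proof.
move=> du dv; rewrite /gext -fsumD; do ?exact: gext_finite_supp.
rewrite (hcompD du dv); apply: eq_fsbigr => x _; apply: FD.
- by have [] := hcompP du.
- by have [] := hcompP dv.
Qed.

End Extension.

Lemma gext_addF (W : nmodType) (F F' : G -> V -> W) v :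
  (forall x, F x 0 = 0) -> (forall x, F' x 0 = 0) -> decomposable Vg v ->
  gext (fun x u => F x u + F' x u) v = gext F v + gext F' v.
Proof. by move=> F0 F'0 dv; rewrite /gext fsumD //; apply: gext_finite_supp. Qed.

End Theory.
End Pregradings.

(** * Biadditive maps and commutation factors *)

Section CommutationFactorTheory.
Variables (K : fieldType) (G : zmodType).
Implicit Types (lam sigma : G -> G -> K) (x y : G).

Section Biadditive.
Variable sigma : G -> G -> K.
Hypothesis sigmaP : biadditive sigma.

Lemma biaddDl x y z : sigma (x + y) z = sigma x z * sigma y z.
Proof. by case: sigmaP. Qed.

Lemma biaddDr x y z : sigma x (y + z) = sigma x y * sigma x z.
Proof. by case: sigmaP. Qed.

Lemma biadd_neq0 x y : sigma x y != 0.
Proof. by case: sigmaP. Qed.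

Lemma biadd0l x : sigma 0 x = 1.
Proof. by apply: (mulfI (biadd_neq0 0 x)); rewrite -biaddDl addr0 mulr1. Qed.

Lemma biadd0r x : sigma x 0 = 1.
Proof. by apply: (mulfI (biadd_neq0 x 0)); rewrite -biaddDr addr0 mulr1. Qed.

Lemma biaddNr x y : sigma x (- y) = (sigma x y)^-1.
Proof.
apply: (mulfI (biadd_neq0 x y)).
by rewrite -biaddDr subrr biadd0r divff // biadd_neq0.
Qed.

Lemma biaddNl x y : sigma (- x) y = (sigma x y)^-1.
Proof.
apply: (mulfI (biadd_neq0 x y)).
by rewrite -biaddDl subrr biadd0l divff // biadd_neq0.
Qed.

End Biadditive.

Section Commutation.
Variable lam : G -> G -> K.
Hypothesis lamP : commutation_factor lam.

Let lamB : biadditive lam. Proof. by case: lamP. Qed.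

Lemma lamC x y : lam x y * lam y x = 1.
Proof. by case: lamP. Qed.

Lemma lam_inv x y : (lam x y)^-1 = lam y x.
Proof.
by apply: (mulfI (biadd_neq0 lamB x y)); rewrite lamC divff // biadd_neq0.
Qed.

Lemma lam_diag_sq x : lam x x * lam x x = 1.
Proof. exact: lamC. Qed.

(** The cross terms [lam x y] and [lam y x] cancel, so the diagonal is a character. *)
Lemma lam_diagD x y : lam (x + y) (x + y) = lam x x * lam y y.
Proof.
by rewrite biaddDl // !biaddDr // -mulrA (mulrA (lam x y)) lamC mul1r.
Qed.

Lemma lam_diagB x y : lam (x - y) (x - y) = lam x x * lam y y.
Proof. by rewrite lam_diagD biaddNl // biaddNr // invrK. Qed.

Lemma sign_parity x : (-1) ^+ parity lam x = lam x x.
Proof.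
rewrite /parity; case: eqP => [-> //|/eqP lN1].
have := lam_diag_sq x; rewrite -expr2 => /eqP.
by rewrite sqrf_eq1 (negbTE lN1) orbF => /eqP->.
Qed.

End Commutation.
End CommutationFactorTheory.

(** * Graded commutative algebras and diagonal rescalings *)

Section GradedAlgebraTheory.
Variables (K : fieldType) (G : zmodType) (lam : G -> G -> K).
Variables (A : pzRingType) (iota : {rmorphism K -> A}) (Ag : G -> set A).
Hypothesis lamP : commutation_factor lam.
Hypothesis AP : graded_commutative_algebra lam iota Ag.

Let lamB : biadditive lam. Proof. by case: lamP. Qed.
Let AgP : pregrading Ag. Proof. exact: grading_pregrading (alg_grading AP). Qed.

Lemma graded_alg_ind (P : A -> Prop) :
  (forall x a, Ag x a -> P a) -> (forall a b, P a -> P b -> P (a + b)) ->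
  forall a, P a.
Proof.
move=> Ph PD a; apply: (decomposable_ind AgP) => // [u v _ _|].
- exact: PD.
- exact: grading_decomposable (alg_grading AP).
Qed.

Lemma mulr_iotaCA k a b : a * (iota k * b) = iota k * (a * b).
Proof. by rewrite !mulrA (iota_central AP). Qed.

Lemma iota_homog k : Ag 0 (iota k).
Proof. by rewrite -[iota k]mulr1; apply: alg_homogZ AP _ _ _ (alg_homog1 AP). Qed.

Lemma homog0_central a c : Ag 0 a -> c * a = a * c.
Proof.
move=> a0; elim/graded_alg_ind: c => [x c cx|c c' IH IH'].
- by rewrite (alg_lam_comm AP cx a0) biadd0r // rmorph1 mul1r.
- by rewrite mulrDl mulrDr IH IH'.
Qed.

(* The diagonal operator multiplying degree [x] by [w x].  For [w = lam y] it is
   the ring automorphism that [m c = phi(c) m] defines for [m] of degree [y]. *)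
Definition gscale (w : G -> K) : A -> A := gext Ag (fun x c => iota (w x) * c).

Implicit Types w : G -> K.

Lemma gscaleD w : {morph gscale w : a b / a + b}.
Proof.
move=> a b; apply: (gextD AgP) => [x|x u v||].
- by rewrite mulr0.
- by rewrite mulrDr.
- exact: grading_decomposable (alg_grading AP).
- exact: grading_decomposable (alg_grading AP).
Qed.

Lemma gscale_homogE w x a : Ag x a -> gscale w a = iota (w x) * a.
Proof. by move=> ax; rewrite /gscale (gext_homog AgP _ ax) // => y; rewrite mulr0. Qed.

Lemma gscale_homog w x a : Ag x a -> Ag x (gscale w a).
Proof. by move=> ax; rewrite (gscale_homogE _ ax); apply: alg_homogZ AP _ _ _ ax. Qed.

Lemma gscale_comp w w' a : gscale w (gscale w' a) = gscale (w \* w') a.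
Proof.
elim/graded_alg_ind: a => [x a ax|a b IHa IHb].
- rewrite !(gscale_homogE _ ax) (gscale_homogE _ (alg_homogZ AP _ ax)).
  by rewrite mulrA -rmorphM.
- by rewrite !gscaleD IHa IHb.
Qed.

Lemma gscale1 w a : (forall x, w x = 1) -> gscale w a = a.
Proof.
move=> w1; elim/graded_alg_ind: a => [x a ax|a b IHa IHb].
- by rewrite (gscale_homogE _ ax) w1 rmorph1 mul1r.
- by rewrite gscaleD IHa IHb.
Qed.

Lemma gscaleK w w' : (forall x, w' x * w x = 1) -> cancel (gscale w) (gscale w').
Proof. by move=> ww' a; rewrite gscale_comp gscale1. Qed.

Lemma gscaleM w : {morph w : x y / x + y >-> x * y} ->
  {morph gscale w : a b / a * b}.
Proof.
move=> wD a b; elim/graded_alg_ind: a => [x a ax|a a' IHa IHa']; last first.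
  by rewrite mulrDl !gscaleD IHa IHa' mulrDl.
elim/graded_alg_ind: b => [y b bY|b b' IHb IHb']; last first.
  by rewrite mulrDr !gscaleD IHb IHb' mulrDr.
rewrite (gscale_homogE _ ax) (gscale_homogE _ bY).
rewrite (gscale_homogE _ (alg_homogM AP ax bY)) wD rmorphM.
by rewrite -!mulrA [in RHS]mulr_iotaCA.
Qed.

Lemma gscale_lamM x : {morph gscale (lam x) : a b / a * b}.
Proof. by apply: gscaleM => y z; rewrite biaddDr. Qed.

Lemma gscale_lamD x y a :
  gscale (lam x) (gscale (lam y) a) = gscale (lam (x + y)) a.
Proof.
by rewrite gscale_comp; congr (gscale _ a); apply: funext => z; rewrite biaddDl.
Qed.

(** The commutation rule with only one factor homogeneous; the scalar becomes the automorphism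
    [gscale (lam x)] of the other factor. *)
Lemma mulr_gscale_lam x a c : Ag x a -> a * c = gscale (lam x) c * a.
Proof.
move=> ax; elim/graded_alg_ind: c => [y c cy|c c' IHc IHc'].
- by rewrite (gscale_homogE _ cy) (alg_lam_comm AP ax cy) mulrA.
- by rewrite mulrDr gscaleD mulrDl IHc IHc'.
Qed.

(** * Left and right actions on a graded module *)

Variables (M : lmodType A) (Mg : G -> set M) (ract : M -> A -> M).
Hypothesis MP : graded_module lam iota Ag Mg ract.

Let MgP : pregrading Mg. Proof. exact: grading_pregrading (mod_grading MP). Qed.

Lemma graded_mod_ind (P : M -> Prop) :
  (forall x m, Mg x m -> P m) -> (forall m n, P m -> P n -> P (m + n)) ->
  forall m, P m.
Proof.
move=> Ph PD m; apply: (decomposable_ind MgP) => // [u v _ _|].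
- exact: PD.
- exact: grading_decomposable (mod_grading MP).
Qed.

Lemma mod_homog_iotaZ x k m : Mg x m -> Mg x (iota k *: m).
Proof.
move=> mx; rewrite -[x]add0r.
by apply: mod_homogZ MP _ _ _ _ _ mx; apply: iota_homog.
Qed.

Lemma scaler_iotaCA k a (m : M) : a *: (iota k *: m) = iota k *: (a *: m).
Proof. by rewrite !scalerA (iota_central AP). Qed.

Lemma ractE y m a : Mg y m -> ract m a = gscale (lam y) a *: m.
Proof.
move=> my; elim/graded_alg_ind: a => [x a ax|a b IHa IHb].
- by rewrite (ract_lam MP my ax) (gscale_homogE _ ax) scalerA.
- by rewrite (ractDr MP) gscaleD scalerDl IHa IHb.
Qed.

(** The two actions commute: for homogeneous [a] and [m], moving [c] to the left past [a *: m]
    amounts to moving it past [m] and then past [a]. *)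
Lemma ract_scale a m c : ract (a *: m) c = a *: ract m c.
Proof.
elim/graded_mod_ind: m => [y m my|m m' IHm IHm']; last first.
  by rewrite scalerDr !(ractDl MP) IHm IHm' scalerDr.
elim/graded_alg_ind: a => [x a ax|a a' IHa IHa']; last first.
  by rewrite !scalerDl !(ractDl MP) IHa IHa'.
rewrite (ractE _ my) (ractE _ (mod_homogZ MP ax my)) !scalerA.
by rewrite (mulr_gscale_lam _ ax) gscale_lamD.
Qed.

Lemma ract_iota m k : ract m (iota k) = iota k *: m.
Proof.
elim/graded_mod_ind: m => [y m my|m m' IHm IHm'].
- by rewrite (ractE _ my) (gscale_homogE _ (iota_homog k)) biadd0r // rmorph1 mul1r.
- by rewrite (ractDl MP) IHm IHm' scalerDr.
Qed.

(** Right linear maps of degree [x] are left semilinear for [gscale (lam x)]. This allows all matrix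
    computations to use left coordinates. *)
Lemma hEnd_scale x f a m : hEnd Mg ract x f ->
  f (a *: m) = gscale (lam x) a *: f m.
Proof.
move=> [fD fR fg]; elim/graded_mod_ind: m => [y m my|m m' IHm IHm']; last first.
  by rewrite scalerDr !fD IHm IHm' scalerDr.
elim/graded_alg_ind: a => [z a az|a a' IHa IHa']; last first.
  by rewrite scalerDl !fD IHa IHa' gscaleD scalerDl.
(* The left multiple is written as a right one, scalars included, so that right linearity applies.
   Going back on [f m], of degree [y + x], costs [lam (y + x) z], and only [lam x z] survives. *)
have faE : a *: m = iota (lam z y) *: ract m a.
  rewrite (ractE _ my) (gscale_homogE _ az) -scalerA scalerA -rmorphM.
  by rewrite lamC // rmorph1 scale1r.
rewrite faE -ract_iota fR fR ract_iota (ractE _ (fg _ _ my)).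
rewrite !(gscale_homogE _ az) biaddDl // scalerA mulrA -rmorphM mulrA.
by rewrite lamC // mul1r.
Qed.
End GradedAlgebraTheory.

(** * The sum of the homogeneous endomorphism spaces is direct *)

Section HomogeneousEndomorphisms.
Variables (G : zmodType) (A : pzRingType) (M : lmodType A) (Mg : G -> set M).
Variable act : M -> A -> M.
Hypothesis MgP : is_grading Mg.
Hypothesis actD : forall m n a, act (m + n) a = act m a + act n a.

Let MgP' : pregrading Mg. Proof. exact: grading_pregrading MgP. Qed.

Lemma decomposes_hEnd_apply f F y m : decomposes (hEnd Mg act) f F -> Mg y m ->
  decomposes Mg (f m) (fun z => F (z - y) m).
Proof.
move=> [Fh fF ->] my; split=> [z||].
- have [_ _ Fg] := Fh (z - y).
  by rewrite -[X in Mg X](subrK y) addrC; apply: Fg.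
- apply: sub_finite_set (finite_image (fun x => x + y) fF) => z /= Fz.
  exists (z - y); last by rewrite subrK.
  by apply: contra_neq Fz => ->.
- rewrite (fsum_sub fF) // fct_sumE -(@fsum_sub _ _ _ (fun x => F x m) fF) /=.
    apply: (@reindex_fsbigT _ _ _ _ _ (fun z => z - y)) => //.
    by exists (fun x => x + y) => x; rewrite ?addrK ?subrK.
  by move=> x; apply: contra_neq => ->.
Qed.

(** On [m] of degree [y], the component [F x m] must be the component of degree [x + y] of [f m],
    hence [f] determines it. The action is left general to cover both [ract] and its twisted
    version. *)
Lemma hEnd_pregrading : pregrading (hEnd Mg act).
Proof.
have act0 a : act 0 a = 0.
  by apply: (addrI (act 0 a)); rewrite -actD !addr0.
have actN m a : act (- m) a = - act m a.
  by apply: (addrI (act m a)); rewrite -actD !subrr.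
split=> [x|x f g [fD fR fg] [gD gR gg]|f F F' fF fF'].
- by split=> [m n|m a|y m _]; rewrite /= ?addr0 ?act0 //; apply: pregrading0.
- split=> [m n|m a|y m my]; rewrite !fctE.
  + by rewrite fD gD opprD addrACA.
  + by rewrite fR gR actD actN.
  + by apply: pregradingB => //; [apply: fg | apply: gg].
- apply: funext => x; apply: funext => m.
  have [[Fh _ _] [Fh' _ _]] := (fF, fF').
  have [FD _ _] := Fh x; have [FD' _ _] := Fh' x.
  have : decomposable Mg m by apply: grading_decomposable.
  elim/(decomposable_ind MgP') => {m} [y m my|u v _ _ IHu IHv]; last first.
    by rewrite FD FD' IHu IHv.
  have := pregrading_uniq MgP' (decomposes_hEnd_apply fF my)
    (decomposes_hEnd_apply fF' my).
  by move=> /(congr1 (fun h => h (x + y))); rewrite !addrK.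
Qed.

End HomogeneousEndomorphisms.

(** * Left coordinates in a homogeneous basis *)

Section Coordinates.
Variables (G : zmodType) (A : pzRingType) (M : lmodType A) (Mg : G -> set M).
Variable b : homogeneous_basis Mg.

Definition lcoord (m : M) : 'I_(hb_rank b) -> A := sval (cid (hb_basis b m)).

Lemma lcoord_sum m : m = \sum_i lcoord m i *: hb_vec b i.
Proof. exact: (svalP (cid (hb_basis b m))).1. Qed.

Lemma lcoord_uniq m c : m = \sum_i c i *: hb_vec b i -> lcoord m = c.
Proof. exact: (svalP (cid (hb_basis b m))).2. Qed.

Lemma lcoordD m n : lcoord (m + n) = lcoord m + lcoord n.
Proof.
apply: lcoord_uniq; rewrite {1}[m]lcoord_sum {1}[n]lcoord_sum -big_split.
by apply: eq_bigr => i _; apply: esym; apply: scalerDl.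
Qed.

Lemma lcoordZ a m i : lcoord (a *: m) i = a * lcoord m i.
Proof.
suff -> : lcoord (a *: m) = (fun i => a * lcoord m i) by [].
apply: lcoord_uniq; rewrite {1}[m]lcoord_sum scaler_sumr.
by apply: eq_bigr => j _; rewrite scalerA.
Qed.

Lemma lcoord_sumE (I : Type) (r : seq I) (F : I -> M) i :
  lcoord (\sum_(k <- r) F k) i = \sum_(k <- r) lcoord (F k) i.
Proof.
elim/big_ind2: _ => // [|m u n v <- <-]; last by rewrite lcoordD.
by rewrite -[0](scale0r 0) lcoordZ mul0r.
Qed.

Lemma lcoord_scale_vec a i j : lcoord (a *: hb_vec b j) i = if i == j then a else 0.
Proof.
suff -> : lcoord (a *: hb_vec b j) = (fun i => if i == j then a else 0) by [].
apply: lcoord_uniq; rewrite (bigD1 j) //= eqxx big1 ?addr0 // => k /negbTE->.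
by rewrite scale0r.
Qed.

End Coordinates.

Arguments lcoord {G A M Mg} b m i.
Arguments lcoord_sum {G A M Mg} b m.

(** * The trace in left coordinates and its cyclicity *)

Section GradedTrace.
Variables (K : fieldType) (G : zmodType) (lam : G -> G -> K).
Variables (A : pzRingType) (iota : {rmorphism K -> A}) (Ag : G -> set A).
Hypothesis lamP : commutation_factor lam.
Hypothesis AP : graded_commutative_algebra lam iota Ag.
Variables (M : lmodType A) (Mg : G -> set M) (ract : M -> A -> M).
Hypothesis MP : graded_module lam iota Ag Mg ract.

Let lamB : biadditive lam. Proof. by case: lamP. Qed.
Let AgP : pregrading Ag. Proof. exact: grading_pregrading (alg_grading AP). Qed.
Let MgP : pregrading Mg. Proof. exact: grading_pregrading (mod_grading MP). Qed.

Implicit Types (b : homogeneous_basis Mg) (f g : M -> M).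

(** Replacing each coordinate by its component of degree [x - hb_deg b i] yields the component of
    degree [x] of [m], which is [m]; uniqueness of coordinates concludes. *)
Lemma lcoord_homog b x m i : Mg x m -> Ag (x - hb_deg b i) (lcoord b m i).
Proof.
move=> mx; pose c i := hcomp Ag (lcoord b m i) (x - hb_deg b i).
suff -> : lcoord b m = c.
  by rewrite /c; have [] := hcompP AgP (grading_decomposable
       (lcoord b m i) (alg_grading AP)).
have dM n : decomposable Mg n by apply: grading_decomposable (mod_grading MP).
have hcompZ a j : hcomp Mg (a *: hb_vec b j) x
    = hcomp Ag a (x - hb_deg b j) *: hb_vec b j.
  elim/(graded_alg_ind AP): a => [z a az|a a' IHa IHa'].
  - rewrite (hcomp_homog AgP az).
    rewrite (hcomp_homog MgP (mod_homogZ MP az (hb_homog j))).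
    by rewrite subr_eq; case: eqP => // _; rewrite scale0r.
  - rewrite scalerDl (hcompD MgP) // (hcompD AgP);
      try exact: grading_decomposable (alg_grading AP).
    by rewrite !fctE IHa IHa' scalerDl.
apply: lcoord_uniq; have /(congr1 (fun h => h x)) := hcomp_homog MgP mx.
rewrite /= eqxx => {1}<-; rewrite {1}[m](lcoord_sum b).
have hcomp_sum (r : seq 'I_(hb_rank b)) (F : 'I_(hb_rank b) -> M) :
    hcomp Mg (\sum_(k <- r) F k) x = \sum_(k <- r) hcomp Mg (F k) x.
  elim/big_ind2: _ => // [|u u' v v' <- <-]; last by rewrite (hcompD MgP).
  by rewrite (hcomp_homog MgP (pregrading0 MgP x)) eqxx.
by rewrite hcomp_sum; apply: eq_bigr => j _; rewrite hcompZ.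
Qed.

(* [iota (lam x x)] is the parity sign [(-1)^x]. *)
Definition lam_trace b f : A :=
  \sum_i iota (lam (hb_deg b i) (hb_deg b i)) * lcoord b (f (hb_vec b i)) i.

Lemma lam_traceD b f g : lam_trace b (f + g) = lam_trace b f + lam_trace b g.
Proof.
by rewrite -big_split; apply: eq_bigr => i _; rewrite !fctE lcoordD mulrDr.
Qed.

Lemma lam_traceZ b a f : lam_trace b (a *: f) = a * lam_trace b f.
Proof.
rewrite mulr_sumr; apply: eq_bigr => i _.
by rewrite !fctE lcoordZ [RHS](mulr_iotaCA AP).
Qed.

Lemma lam_trace_homog b x f : hEnd Mg ract x f -> Ag x (lam_trace b f).
Proof.
move=> [_ _ fg]; apply: (homog_sum AgP) => i _; apply: (alg_homogZ AP).
have /(lcoord_homog i) := fg _ _ (hb_homog i).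
by rewrite addrAC subrr add0r.
Qed.

(* Taking [g = id] compares the traces in two bases; taking [b = b'] gives the
   trace property. *)
Lemma lam_trace_comp b b' x y f g : hEnd Mg ract x f -> hEnd Mg ract y g ->
  lam_trace b (f \o g) = iota (lam x y) * lam_trace b' (g \o f).
Proof.
(* A diagonal coordinate of [u \o v], expanded through an intermediate basis [c']. The factor [lam]
   comes from moving [u] past a coordinate of degree [hb_deg c i + w - hb_deg c' j]. *)
have compE (c c' : homogeneous_basis Mg) z w u v i :
    hEnd Mg ract z u -> hEnd Mg ract w v ->
    lcoord c (u (v (hb_vec c i))) i = \sum_j
      iota (lam z (hb_deg c i + w - hb_deg c' j)) *
      (lcoord c' (v (hb_vec c i)) j * lcoord c (u (hb_vec c' j)) i).
  move=> zu [_ _ vg]; rewrite {1}[v _](lcoord_sum c').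
  have uS (F : 'I_(hb_rank c') -> M) : u (\sum_j F j) = \sum_j u (F j).
    have [uD _ _] := zu; elim/big_rec2: _ => [|j m n _ <- //].
    by apply: (addrI (u 0)); rewrite -uD !addr0.
  rewrite uS lcoord_sumE; apply: eq_bigr => j _.
  rewrite (hEnd_scale lamP AP MP _ _ zu) lcoordZ mulrA.
  congr (_ * _); apply: (gscale_homogE AP).
  exact: lcoord_homog (vg _ _ (hb_homog i)).
move=> xf yg; rewrite /lam_trace.
under eq_bigr do rewrite /= (compE _ b' _ _ _ _ _ xf yg) mulr_sumr.
under [in RHS]eq_bigr do rewrite /= (compE _ b _ _ _ _ _ yg xf) mulr_sumr.
rewrite exchange_big mulr_sumr; apply: eq_bigr => j _ /=.
rewrite mulr_sumr; apply: eq_bigr => i _.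
have [_ _ fg] := xf; have [_ _ gg] := yg.
have Fh := lcoord_homog i (fg _ _ (hb_homog j)).
have Gh := lcoord_homog j (gg _ _ (hb_homog i)).
(* Once the two coordinates are commuted, the terms differ only by scalars of [K]. *)
rewrite (alg_lam_comm AP Fh Gh) !mulrA -!rmorphM; do 2 congr (_ * _).
congr (iota _).
set p := hb_deg b i; set q := hb_deg b' j.
(* With [d = p - q] the coordinates have degrees [y + d] and [x - d], and [lam p p] equals
   [lam q q * lam d d]; so [lam q q] is a common factor and an identity in [x], [y], [d] remains. *)
have -> : p + y - q = y + (p - q) by rewrite addrAC addrC.
have -> : q + x - p = x - (p - q) by rewrite opprB addrAC addrC.
have <- : lam q q * lam (p - q) (p - q) = lam p p.
  by rewrite lam_diagB // mulrCA lam_diag_sq // mulr1.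
move: (p - q) => d.
have E : lam y (x - d) * lam (x - d) (y + d) = lam x d * lam d d.
  rewrite (biaddDr lamB (x - d)) mulrA lamC // mul1r.
  by rewrite biaddDl // biaddNl // lam_inv.
by rewrite -[RHS]mulrA E biaddDr // mulrC mulrACA.
Qed.

End GradedTrace.

(** * The twisted module and the supertrace composed with [eta] *)

Section TwistedSupertrace.
Variables (K : fieldType) (G : zmodType) (lam : G -> G -> K).
Variables (A : pzRingType) (iota : {rmorphism K -> A}) (Ag : G -> set A).
Hypothesis lamP : commutation_factor lam.
Hypothesis AP : graded_commutative_algebra lam iota Ag.
Variables (M : lmodType A) (Mg : G -> set M) (ract : M -> A -> M).
Hypothesis MP : graded_module lam iota Ag Mg ract.
Variable sigma : G -> G -> K.
Hypothesis sigmaP : NS_multiplier lam sigma.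

Let lamB : biadditive lam. Proof. by case: lamP. Qed.
Let sigmaB : biadditive sigma. Proof. by case: sigmaP. Qed.
Let AgP : pregrading Ag. Proof. exact: grading_pregrading (alg_grading AP). Qed.
Let MgP : pregrading Mg. Proof. exact: grading_pregrading (mod_grading MP). Qed.
Let EgP : pregrading (hEnd Mg ract).
Proof. exact: hEnd_pregrading (mod_grading MP) (ractDl MP). Qed.
Let Adec a : decomposable Ag a.
Proof. exact: grading_decomposable (alg_grading AP). Qed.
Let Mdec m : decomposable Mg m.
Proof. exact: grading_decomposable (mod_grading MP). Qed.

Local Notation lact := (star_lact iota Ag Mg sigma).
Local Notation sract := (star_ract lam iota Ag Mg sigma).
Local Notation eta := (Defs.eta iota Mg sigma ract).

(** The scalar by which the twisted right action of degree [y] on a vector of degree [x] differs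
    from the original left action. *)
Definition star_factor (x y : G) : K :=
  (-1) ^+ (parity lam x * parity lam y)%N * sigma y x.

Lemma star_factor_neq0 x y : star_factor x y != 0.
Proof. by rewrite mulf_neq0 ?signr_eq0 ?biadd_neq0. Qed.

Lemma parity_signD x y z : (-1) ^+ (parity lam (x + y) * parity lam z)%N
  = (-1) ^+ (parity lam x * parity lam z)%N
    * (-1) ^+ (parity lam y * parity lam z)%N :> K.
Proof. by rewrite !exprM !sign_parity // lam_diagD // exprMn. Qed.

(** The scalar identity behind right linearity of [eta f] for the twisted action; the defining
    relation of NS-multipliers trades [sigma x z * lam x z] for a sign times [sigma z x]. *)
Lemma star_factorD x y z :
  star_factor (y + x) z * sigma x y = sigma x (z + y) * lam x z * star_factor y z.
Proof.
have [_ /(_ x z) NS] := sigmaP.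
have {}NS : sigma x z * lam x z
    = (-1) ^+ (parity lam x * parity lam z)%N * sigma z x.
  by rewrite -NS divfK ?biadd_neq0 // mulrC.
rewrite /star_factor parity_signD !biaddDr // [X in X * _ = _]mulrACA -NS.
ring.
Qed.

(** Here [sigma] disappears: its value from [eta] cancels the one from the twisted right
    coordinates, and the sign of [str] reduces to the parity of [y]. *)
Lemma star_factor_diag x y :
  (-1) ^+ (parity lam y * (parity lam y + parity lam x))%N
    * ((star_factor y x)^-1 * sigma x y) = lam y y.
Proof.
rewrite /star_factor invfM invr_sign mulfVK ?biadd_neq0 // mulnDr exprD.
by rewrite -mulrA -expr2 sqrr_sign mulr1 mulnb andbb sign_parity.
Qed.

Lemma star_lactE y a m : Mg y m -> lact a m = gscale iota Ag (sigma^~ y) a *: m.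
Proof.
move=> my; have -> : lact a m
    = gext Ag (fun x c => iota (sigma x y) *: (c *: m)) a.
  apply: eq_fsbigr => x _.
  rewrite -/(gext Mg (fun y m => iota (sigma x y) *: (_ *: m)) m).
  by rewrite (gext_homog MgP _ my) // => z; rewrite !scaler0.
have F0 x : iota (sigma x y) *: ((0 : A) *: m) = 0.
  by rewrite scale0r scaler0.
elim/(graded_alg_ind AP): a => [x a ax|a a' IHa IHa'].
- by rewrite (gext_homog AgP F0 ax) (gscale_homogE AP _ ax) scalerA.
- rewrite (gextD AgP F0) //; last by move=> x u v _ _; rewrite scalerDl scalerDr.
  by rewrite IHa IHa' (gscaleD AP) scalerDl.
Qed.

Lemma star_ractE x m a : Mg x m ->
  sract m a = gscale iota Ag (star_factor x) a *: m.
Proof.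
move=> mx; have lact0 c : lact c 0 = 0.
  by rewrite (star_lactE _ (pregrading0 MgP 0)) scaler0.
pose F y c := iota ((-1) ^+ (parity lam x * parity lam y)%N) *: lact c m.
have -> : sract m a = gext Ag F a.
  apply: (gext_homog MgP (F := fun x m => gext Ag (fun y c =>
    iota ((-1) ^+ (parity lam x * parity lam y)%N) *: lact c m) a) _ mx).
  by move=> z; apply: fsbig1 => y _; rewrite lact0 scaler0.
have FE y c : Ag y c -> F y c = (iota (star_factor x y) * c) *: m.
  move=> cy; rewrite /F (star_lactE _ mx) (gscale_homogE AP _ cy) scalerA mulrA.
  by rewrite -rmorphM.
have F0 y : F y 0 = 0.
  by rewrite FE ?mulr0 ?scale0r //; apply: pregrading0.
elim/(graded_alg_ind AP): a => [y a ay|a a' IHa IHa'].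
- by rewrite (gext_homog AgP F0 ay) (gscale_homogE AP _ ay) FE.
- rewrite (gextD AgP F0) // => [|y u v yu yv].
    by rewrite IHa IHa' (gscaleD AP) scalerDl.
  by rewrite !FE //; [rewrite mulrDr scalerDl | apply: homogD].
Qed.

Lemma star_ractDl m n a : sract (m + n) a = sract m a + sract n a.
Proof.
pose F x u := gext Ag (fun y c =>
  iota ((-1) ^+ (parity lam x * parity lam y)%N) *: lact c u) a.
have FE x u : Mg x u -> F x u = gscale iota Ag (star_factor x) a *: u.
  move=> xu; rewrite -(star_ractE _ xu).
  rewrite -[LHS](gext_homog MgP (F := F) _ xu) // => z.
  apply: fsbig1 => y _.
  by rewrite (star_lactE _ (pregrading0 MgP 0)) !scaler0.
apply: (gextD MgP (F := F)) => // [x|x u v xu xv].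
- by rewrite FE ?scaler0 //; apply: pregrading0.
- by rewrite !FE ?scalerDr //; apply: homogD.
Qed.

Let SgP : pregrading (hEnd Mg sract).
Proof. exact: hEnd_pregrading (mod_grading MP) star_ractDl. Qed.

Lemma eta_homogE x f : hEnd Mg ract x f ->
  eta f = fun m => gext Mg (fun y n => iota (sigma x y) *: f n) m.
Proof.
move=> xf; apply: funext => m; apply: (gext_homog EgP (F := fun x g =>
  gext Mg (fun y n => iota (sigma x y) *: g n) m) _ xf) => z.
by apply: fsbig1 => y _; rewrite scaler0.
Qed.

Lemma hEnd0 act x f : hEnd Mg act x f -> f 0 = 0.
Proof. by move=> [fD _ _]; apply: (addrI (f 0)); rewrite -fD !addr0. Qed.

Lemma etaE x y f m : hEnd Mg ract x f -> Mg y m ->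
  eta f m = iota (sigma x y) *: f m.
Proof.
move=> xf my; rewrite (eta_homogE xf) (gext_homog MgP _ my) // => z.
by rewrite (hEnd0 xf) scaler0.
Qed.

(** Stated on [gEnd], where [hcomp] gives genuine components. *)
Lemma etaD f g : gEnd Mg ract f -> gEnd Mg ract g -> eta (f + g) = eta f + eta g.
Proof.
move=> df dg; apply: funext => m; apply: (gextD EgP (F := fun x g =>
  gext Mg (fun y n => iota (sigma x y) *: g n) m)) => // [x|x u v xu xv].
- by apply: fsbig1 => y _; rewrite scaler0.
- rewrite -(gext_addF MgP) // => [|y|y].
  + by apply: eq_fsbigr => y _; rewrite !fctE scalerDr.
  + by rewrite (hEnd0 xu) scaler0.
  + by rewrite (hEnd0 xv) scaler0.
Qed.

Lemma eta_homog x f : hEnd Mg ract x f -> hEnd Mg sract x (eta f).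
Proof.
move=> xf; have [fD fR fg] := xf.
have etafD m n : eta f (m + n) = eta f m + eta f n.
  rewrite (eta_homogE xf); apply: (gextD MgP) => // [y|y u v _ _].
  - by rewrite (hEnd0 xf) scaler0.
  - by rewrite fD scalerDr.
have etafg y m : Mg y m -> Mg (y + x) (eta f m).
  by move=> my; rewrite (etaE xf my); apply: (mod_homog_iotaZ AP MP); apply: fg.
split=> // m a.
(* Right linearity is additive in [m] and in [a]; for homogeneous ones it becomes [star_factorD]. *)
elim/(graded_mod_ind MP): m => [y m my|m m' IHm IHm']; last first.
  by rewrite star_ractDl !etafD IHm IHm' star_ractDl.
elim/(graded_alg_ind AP): a => [z a az|a a' IHa IHa']; last first.
  have SD w n : Mg w n -> sract n (a + a') = sract n a + sract n a'.
    by move=> wn; rewrite !(star_ractE _ wn) (gscaleD AP) scalerDl.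
  by rewrite (SD _ _ my) etafD IHa IHa' (SD _ _ (etafg _ _ my)).
rewrite (star_ractE _ (etafg _ _ my)) (star_ractE _ my) (etaE xf my).
have caz := gscale_homog AP (star_factor y) az.
rewrite (etaE xf (mod_homogZ MP caz my)) (hEnd_scale lamP AP MP _ _ xf).
rewrite (gscale_homogE AP _ caz) !(gscale_homogE AP _ az) -(scaler_iotaCA AP).
rewrite !scalerA -!mulrA !(mulrA (iota _) (iota _)) -!rmorphM.
rewrite -!(iota_central AP) !mulrA -!rmorphM star_factorD.
by congr ((iota _ * _) *: _); rewrite /star_factor; ring.
Qed.

Variable b : homogeneous_basis Mg.

(** The twisted right multiple of a basis vector is a left multiple rescaled by the nonzero
    [star_factor]; inverting this rescaling gives existence and uniqueness of right coordinates, so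
    [xget] never returns its default. *)
Lemma rcoord_star m i : rcoord sract (hb_vec b) m i
  = gscale iota Ag (fun z => (star_factor (hb_deg b i) z)^-1) (lcoord b m i).
Proof.
set w := fun j z => (star_factor (hb_deg b j) z)^-1.
rewrite /rcoord.
rewrite (@xget_unique _ _ _ (fun j => gscale iota Ag (w j) (lcoord b m j))) //=.
  rewrite {1}[m](lcoord_sum b); apply: eq_bigr => j _.
  rewrite (star_ractE _ (hb_homog j)) (gscaleK AP) // => z.
  by rewrite divff // star_factor_neq0.
move=> c mE; apply: funext => j.
rewrite (@lcoord_uniq _ _ _ _ _ _
  (fun j => gscale iota Ag (star_factor (hb_deg b j)) (c j))).
  by rewrite (gscaleK AP) // => z; rewrite mulVf // star_factor_neq0.
by rewrite mE; apply: eq_bigr => k _; rewrite (star_ractE _ (hb_homog k)).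
Qed.

(** The degree [x] part of [str], isolated so that [str] is [gext] of this family. *)
Let strF x (h : M -> M) : A := \sum_(i < hb_rank b)
  (-1) ^+ (parity lam (hb_deg b i) * (parity lam (hb_deg b i) + parity lam x))%N
  * rcoord sract (hb_vec b) (h (hb_vec b i)) i.

Let strFD x h h' : strF x (h + h') = strF x h + strF x h'.
Proof.
rewrite -big_split; apply: eq_bigr => i _.
by rewrite !rcoord_star /= -mulrDr -(gscaleD AP) !fctE lcoordD.
Qed.

Let strF0 x : strF x 0 = 0.
Proof. by apply: (addrI (strF x 0)); rewrite -strFD !addr0. Qed.

Lemma Gtr_lam_trace f : gEnd Mg ract f ->
  Gtr lam iota Ag sigma ract b f = lam_trace lam iota b f.
Proof.
elim/(decomposable_ind EgP) => {f} [x f xf|f g df dg IHf IHg]; last first.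
  (* Additivity of [str] holds on decomposable maps only. *)
  have eta_dec h : gEnd Mg ract h -> decomposable (hEnd Mg sract) (eta h).
    elim/(decomposable_ind EgP) => {}h.
    - by move=> u /eta_homog/(homog_decomposable SgP).
    - by move=> u dh du IHh IHu; rewrite etaD //; apply: decomposableD.
  rewrite /Gtr etaD // lam_traceD -IHf -IHg.
  by apply: (gextD SgP (F := strF)) => //; apply: eta_dec.
rewrite /Gtr [LHS](gext_homog SgP (F := strF) strF0 (eta_homog xf)).
apply: eq_bigr => i _; rewrite rcoord_star (etaE xf (hb_homog i)) lcoordZ.
have [_ _ fg] := xf.
(* Diagonal coordinates of [f] have the degree [x] of [f], so the rescaling of right coordinates is
   by the single scalar that [star_factor_diag] handles. *)
have := lcoord_homog AP MP i (fg _ _ (hb_homog i)).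
rewrite addrAC subrr add0r => /[dup] ci /(alg_homogZ AP (sigma x (hb_deg b i))).
move=> /(gscale_homogE AP) ->; rewrite -(rmorphN1 iota) -rmorphXn !mulrA -!rmorphM.
congr (iota _ * _).
by rewrite -mulrA star_factor_diag.
Qed.

End TwistedSupertrace.

(** * Algebra of graded endomorphisms *)

Section Uniqueness.
Variables (K : fieldType) (G : zmodType) (lam : G -> G -> K).
Variables (A : pzRingType) (iota : {rmorphism K -> A}) (Ag : G -> set A).
Hypothesis lamP : commutation_factor lam.
Hypothesis AP : graded_commutative_algebra lam iota Ag.
Variables (M : lmodType A) (Mg : G -> set M) (ract : M -> A -> M).
Hypothesis MP : graded_module lam iota Ag Mg ract.

Let lamB : biadditive lam. Proof. by case: lamP. Qed.
Let EgP : pregrading (hEnd Mg ract).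
Proof. exact: hEnd_pregrading (mod_grading MP) (ractDl MP). Qed.

Lemma hEnd_gEnd x f : hEnd Mg ract x f -> gEnd Mg ract f.
Proof. exact: homog_decomposable. Qed.

Lemma hEnd_comp x y f g : hEnd Mg ract x f -> hEnd Mg ract y g ->
  hEnd Mg ract (x + y) (f \o g).
Proof.
move=> [fD fR fg] [gD gR gg]; split=> [m n|m a|z m mz] /=.
- by rewrite gD fD.
- by rewrite gR fR.
- by rewrite [x + y]addrC addrA; apply: fg; apply: gg.
Qed.

Lemma hEndZ x y a f : Ag x a -> hEnd Mg ract y f -> hEnd Mg ract (x + y) (a *: f).
Proof.
move=> ax [fD fR fg]; split=> [m n|m c|z m mz]; rewrite !fctE.
- by rewrite fD scalerDr.
- by rewrite fR (ract_scale lamP AP MP).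
- by rewrite addrCA; apply: (mod_homogZ MP ax); apply: fg.
Qed.

Lemma gEndZ a f : gEnd Mg ract f -> gEnd Mg ract (a *: f).
Proof.
elim/(decomposable_ind EgP) => {f} [y f yf|f g _ _ IHf IHg]; last first.
  by rewrite scalerDr; apply: decomposableD.
elim/(graded_alg_ind AP): a => [x a ax|a a' IHa IHa'].
- exact: hEnd_gEnd (hEndZ ax yf).
- by rewrite scalerDl; apply: decomposableD.
Qed.

Lemma alg_bracket_eq0 x y a c : Ag x a -> Ag y c -> alg_bracket lam iota x y a c = 0.
Proof. by move=> ax cy; rewrite /alg_bracket (alg_lam_comm AP ax cy) subrr. Qed.

(** Puts the bracket in a form to which additivity and [A]-linearity of a trace apply. *)
Lemma End_bracketE x y (f g : M -> M) : End_bracket lam iota x y f g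
  = f \o g + (- iota (lam x y)) *: (g \o f).
Proof. by rewrite scaleNr. Qed.

Lemma End_bracket_gEnd x y f g : hEnd Mg ract x f -> hEnd Mg ract y g ->
  gEnd Mg ract (f \o g) /\ gEnd Mg ract ((- iota (lam x y)) *: (g \o f)).
Proof.
move=> xf yg; split; [|apply: gEndZ]; apply: hEnd_gEnd;
  by apply: hEnd_comp; eassumption.
Qed.

(** * Matrix units and rigidity of graded traces *)

Section ElementaryMatrices.
Variable b : homogeneous_basis Mg.
Implicit Types i j : 'I_(hb_rank b).

Lemma lcoord_ract m c j :
  lcoord b (ract m c) j = lcoord b m j * gscale iota Ag (lam (hb_deg b j)) c.
Proof.
pose d j := lcoord b m j * gscale iota Ag (lam (hb_deg b j)) c.
suff -> : lcoord b (ract m c) = d by [].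
apply: lcoord_uniq; rewrite {1}[m](lcoord_sum b).
have ract_sum (r : seq 'I_(hb_rank b)) (F : 'I_(hb_rank b) -> M) :
    ract (\sum_(k <- r) F k) c = \sum_(k <- r) ract (F k) c.
  elim/big_ind2: _ => // [|u u' v v' <- <-]; last by rewrite (ractDl MP).
  by apply: (addrI (ract 0 c)); rewrite -(ractDl MP) !addr0.
rewrite ract_sum; apply: eq_bigr => k _.
by rewrite (ract_scale lamP AP MP) (ractE AP MP _ (hb_homog k)) scalerA.
Qed.

(* The right linear map sending [e_j] to [e_i] and the other basis vectors to
   0; the twist appears because [lcoord] gives left coordinates. *)
Definition elem_mx i j : M -> M := fun m =>
  gscale iota Ag (lam (hb_deg b i - hb_deg b j)) (lcoord b m j) *: hb_vec b i.

Lemma elem_mx_homog i j : hEnd Mg ract (hb_deg b i - hb_deg b j) (elem_mx i j).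
Proof.
split=> [m n|m c|y m my]; rewrite /elem_mx.
- by rewrite lcoordD (gscaleD AP) scalerDl.
- rewrite lcoord_ract (gscale_lamM lamP AP) (gscale_lamD lamP AP) subrK.
  by rewrite (ract_scale lamP AP MP) (ractE AP MP _ (hb_homog i)) scalerA.
- rewrite addrA addrAC; apply: (mod_homogZ MP _ (hb_homog i)).
  by apply: (gscale_homog AP); apply: (lcoord_homog AP MP j my).
Qed.

(** The usual relations survive because the twists of composable units add up: the middle degree
    cancels. *)
Lemma elem_mx_comp i j k l :
  elem_mx i j \o elem_mx k l = if j == k then elem_mx i l else 0.
Proof.
apply: funext => m; rewrite /elem_mx /= lcoord_scale_vec.
case: eqP => [->|_].
- by rewrite (gscale_lamD lamP AP) addrA subrK.
- have -> : gscale iota Ag (lam (hb_deg b i - hb_deg b j)) 0 = 0.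
    by apply: (addrI (gscale iota Ag (lam (hb_deg b i - hb_deg b j)) 0));
      rewrite -(gscaleD AP) !addr0.
  by rewrite scale0r.
Qed.

Lemma hEnd_elem_mxE x f : hEnd Mg ract x f ->
  f = \sum_j \sum_i lcoord b (f (hb_vec b j)) i *: elem_mx i j.
Proof.
move=> xf; have [fD _ fg] := xf; apply: funext => m.
have f_sum (r : seq 'I_(hb_rank b)) (F : 'I_(hb_rank b) -> M) :
    f (\sum_(k <- r) F k) = \sum_(k <- r) f (F k).
  elim/big_ind2: _ => // [|u u' v v' <- <-]; last by rewrite fD.
  by apply: (addrI (f 0)); rewrite -fD !addr0.
rewrite {1}[m](lcoord_sum b) f_sum fct_sumE; apply: eq_bigr => j _.
rewrite (hEnd_scale lamP AP MP _ _ xf) {1}[f _](lcoord_sum b) scaler_sumr fct_sumE.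
apply: eq_bigr => i _; rewrite !fctE /elem_mx !scalerA; congr (_ *: _).
(* The degree of the matrix coefficient and the twist of [elem_mx i j] add up to [x], the twist
   produced by [f]. *)
rewrite (mulr_gscale_lam AP _ (lcoord_homog AP MP i (fg _ _ (hb_homog j)))).
rewrite (gscale_lamD lamP AP) addrA subrK.
by rewrite [hb_deg b j + x]addrC addrK.
Qed.

Variable t : (M -> M) -> A.
Hypothesis tP : graded_trace lam iota Ag Mg ract t.

(** Brackets of homogeneous elements of [A] vanish, so the Lie morphism condition becomes cyclicity
    up to [lam]. *)
Lemma gtrace_comp x y f g : hEnd Mg ract x f -> hEnd Mg ract y g ->
  t (f \o g) = iota (lam x y) * t (g \o f).
Proof.
move=> xf yg; apply/eqP; rewrite -subr_eq0; apply/eqP.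
rewrite -[RHS](alg_bracket_eq0 (gtrace_homog tP xf) (gtrace_homog tP yg)).
rewrite -(gtrace_bracket tP xf yg) End_bracketE.
have [fg gf] := End_bracket_gEnd xf yg.
rewrite (gtraceD tP fg gf) (gtraceZ tP) ?mulNr //.
by have [] := End_bracket_gEnd yg xf.
Qed.

Lemma gtrace0 : t 0 = 0.
Proof.
rewrite -[X in t X](scale0r (0 : M -> M)) (gtraceZ tP) ?mul0r //.
exact: hEnd_gEnd (pregrading0 EgP 0).
Qed.

(** Membership in [gEnd] is proved together with additivity, as each induction step requires it, and
    so does nesting two sums. *)
Lemma gtrace_sum (I : Type) (r : seq I) (F : I -> M -> M) :
  (forall k, gEnd Mg ract (F k)) ->
  gEnd Mg ract (\sum_(k <- r) F k) /\ t (\sum_(k <- r) F k) = \sum_(k <- r) t (F k).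
Proof.
move=> gF; elim: r => [|k r [IH1 IH2]].
  by rewrite !big_nil gtrace0; split=> //; apply: hEnd_gEnd (pregrading0 EgP 0).
rewrite !big_cons (gtraceD tP (gF k) IH1) IH2; split=> //.
exact: (decomposableD EgP (gF k) IH1).
Qed.

Lemma gtrace_elem_mx_offdiag i j : i != j -> t (elem_mx i j) = 0.
Proof.
move=> ij; have -> : elem_mx i j = elem_mx i j \o elem_mx j j.
  by rewrite elem_mx_comp eqxx.
rewrite (gtrace_comp (elem_mx_homog i j) (elem_mx_homog j j)) elem_mx_comp.
by rewrite eq_sym (negbTE ij) gtrace0 mulr0.
Qed.

Lemma gtrace_elem_mx_diag i j : t (elem_mx i i) =
  iota (lam (hb_deg b i) (hb_deg b i) * lam (hb_deg b j) (hb_deg b j))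
    * t (elem_mx j j).
Proof.
have -> : elem_mx i i = elem_mx i j \o elem_mx j i by rewrite elem_mx_comp eqxx.
rewrite (gtrace_comp (elem_mx_homog i j) (elem_mx_homog j i)) elem_mx_comp eqxx.
(* The two units have opposite degrees [d] and [- d], and [lam d (- d)] equals [lam d d]. *)
by rewrite -[hb_deg b j - hb_deg b i]opprB biaddNr // lam_inv // lam_diagB.
Qed.

Lemma gtrace_hEndE x f : hEnd Mg ract x f ->
  t f = \sum_i lcoord b (f (hb_vec b i)) i * t (elem_mx i i).
Proof.
move=> xf; rewrite {1}(hEnd_elem_mxE xf).
have gE i j : gEnd Mg ract (lcoord b (f (hb_vec b j)) i *: elem_mx i j).
  by apply: gEndZ; apply: hEnd_gEnd (elem_mx_homog i j).
rewrite (gtrace_sum _ (fun j => (gtrace_sum _ (gE^~ j)).1)).2.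
apply: eq_bigr => j _; rewrite (gtrace_sum _ (gE^~ j)).2 (bigD1 j) //=.
rewrite big1 ?addr0 => [|i ij]; rewrite (gtraceZ tP) //;
  try exact: hEnd_gEnd (elem_mx_homog _ _).
by rewrite gtrace_elem_mx_offdiag // mulr0.
Qed.

Lemma gtrace_unique : exists2 a, Ag 0 a &
  forall f, gEnd Mg ract f -> t f = a * lam_trace lam iota b f.
Proof.
suff [a a0 aP] : exists2 a, Ag 0 a & forall x f, hEnd Mg ract x f ->
    t f = a * lam_trace lam iota b f.
  exists a => // f; elim/(decomposable_ind EgP) => {}f; first exact: aP.
  by move=> g df dg IHf IHg; rewrite (gtraceD tP df dg) lam_traceD mulrDr IHf IHg.
(* In rank 0 there is no diagonal unit to choose, but every graded trace vanishes on homogeneous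
   maps and [a = 0] works. *)
case: (pickP (fun _ : 'I_(hb_rank b) => true)) => [k _|nob]; last first.
  exists 0 => [|x f xf].
  - by apply: (pregrading0 (grading_pregrading (alg_grading AP))).
  - by rewrite (gtrace_hEndE xf) mul0r big1 // => i; have := nob i.
(* Chosen so that the value of [t] on each [elem_mx i i] is the sign of [e_i] times [c]; it has
   degree 0 because [elem_mx k k] does. *)
set c := iota (lam (hb_deg b k) (hb_deg b k)) * t (elem_mx k k).
have c0 : Ag 0 c.
  apply: (alg_homogZ AP); rewrite -(subrr (hb_deg b k)).
  exact: gtrace_homog tP _ _ (elem_mx_homog k k).
exists c => // x f xf; rewrite (gtrace_hEndE xf) mulr_sumr.
apply: eq_bigr => i _; rewrite (gtrace_elem_mx_diag i k) rmorphM -mulrA -/c.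
(* Degree 0 makes [c] central, so it can be moved in front of the coordinate. *)
rewrite (mulr_iotaCA AP) (homog0_central lamP AP _ c0).
by rewrite -(mulr_iotaCA AP).
Qed.

End ElementaryMatrices.

(** Formulated for any [t] that agrees with [lam_trace] on [gEnd], since this is all that is known
    of [Gtr]. *)
Lemma lam_trace_graded_trace (b : homogeneous_basis Mg) (t : (M -> M) -> A) :
  (forall f, gEnd Mg ract f -> t f = lam_trace lam iota b f) ->
  graded_trace lam iota Ag Mg ract t.
Proof.
move=> tE; split=> [f g df dg|a f df|x f xf|x y f g xf yg].
- by rewrite !tE ?lam_traceD //; apply: decomposableD.
- by rewrite !tE ?(lam_traceZ AP) //; apply: gEndZ.
- by rewrite (tE _ (hEnd_gEnd xf)); apply: (lam_trace_homog AP MP _ xf).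
- have [dfg dgf] := End_bracket_gEnd xf yg.
  rewrite End_bracketE tE; last exact: decomposableD.
  rewrite lam_traceD (lam_traceZ AP) mulNr.
  rewrite (lam_trace_comp lamP AP MP b b xf yg) subrr alg_bracket_eq0 //.
  + by rewrite (tE _ (hEnd_gEnd xf)); apply: (lam_trace_homog AP MP _ xf).
  + by rewrite (tE _ (hEnd_gEnd yg)); apply: (lam_trace_homog AP MP _ yg).
Qed.

End Uniqueness.

(** * Independence of the basis and conclusion *)

Lemma lam_trace_basis_indep (K : fieldType) (G : zmodType) (lam : G -> G -> K)
  (A : pzRingType) (iota : {rmorphism K -> A}) (Ag : G -> set A) (M : lmodType A)
  (Mg : G -> set M) (ract : M -> A -> M) (b b' : homogeneous_basis Mg) f :
  commutation_factor lam -> graded_commutative_algebra lam iota Ag ->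
  graded_module lam iota Ag Mg ract -> gEnd Mg ract f ->
  lam_trace lam iota b' f = lam_trace lam iota b f.
Proof.
move=> lamP AP MP; have EgP := hEnd_pregrading (mod_grading MP) (ractDl MP).
elim/(decomposable_ind EgP) => {f} [x f xf|f g _ _ IHf IHg]; last first.
  by rewrite !lam_traceD IHf IHg.
(* The identity has degree 0, so exchanging it with [f] while changing the basis costs only
   [lam x 0 = 1]. *)
have id0 : hEnd Mg ract 0 idfun by split=> // y m; rewrite addr0.
rewrite -[f in LHS]/(f \o idfun) (lam_trace_comp lamP AP MP b' b xf id0).
by rewrite biadd0r ?rmorph1 ?mul1r //; case: lamP.
Qed.

Theorem theorem2 (K : fieldType) (charK : [pchar K] =i pred0)
  (G : zmodType) (fgG : finitely_generated G)
  (lam : G -> G -> K) (lamP : commutation_factor lam)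
  (A : pzRingType) (iota : {rmorphism K -> A}) (Ag : G -> set A)
  (AP : graded_commutative_algebra lam iota Ag)
  (M : lmodType A) (Mg : G -> set M) (ract : M -> A -> M)
  (MP : graded_module lam iota Ag Mg ract)
  (b : homogeneous_basis Mg)
  (sigma : G -> G -> K) (sigmaP : NS_multiplier lam sigma) :
  [/\ graded_trace lam iota Ag Mg ract (Gtr lam iota Ag sigma ract b),
      forall (sigma' : G -> G -> K) (b' : homogeneous_basis Mg),
        NS_multiplier lam sigma' ->
        forall f, gEnd Mg ract f ->
          Gtr lam iota Ag sigma' ract b' f = Gtr lam iota Ag sigma ract b f
    & forall t : (M -> M) -> A, graded_trace lam iota Ag Mg ract t ->
        exists2 a, Ag 0 a &
          forall f, gEnd Mg ract f -> t f = a * Gtr lam iota Ag sigma ract b f].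
Proof.
have GtrE s c := @Gtr_lam_trace _ _ _ _ _ _ lamP AP _ _ _ MP s ^~ c.
split=> [|sigma' b' sigma'P f df|t tP].
- exact: (lam_trace_graded_trace lamP AP MP (GtrE _ _ sigmaP)).
- by rewrite !GtrE // (lam_trace_basis_indep b b' lamP AP MP df).
- have [a a0 aP] := gtrace_unique lamP AP MP b tP.
  by exists a => // f df; rewrite aP // GtrE.
Qed.
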